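(* Let $X$ be a real normed space with $\dim X\ge 2$. The following assertions are equivalent: (i) $X$ is smooth. (ii) There exist a normed space $Y$ and a nonvanishing linear mapping $T:X\to Y$ such that $x\perp_{\rho_*}y\Longrightarrow Tx\perp_{\rho_+}Ty$ for all $x,y\in X$. (iii) There exist a normed space $Y$ and a nonvanishing linear mapping $T:X\to Y$ such that $x\perp_{\rho_*}y\Longrightarrow Tx\perp_{\rho_-}Ty$ for all $x,y\in X$.
   Context: Normed spaces are real. The norm derivatives are $\rho_{\pm}(x,y):=\lim_{t\to 0^{\pm}}\frac{\|x+ty\|^2-\|x\|^2}{2t}$. Put $\rho_*(x,y):=\rho_-(x,y)\rho_+(x,y)$. For $\diamondsuit\in\{\rho_-,\rho_+,\rho_*\}$, $x\perp_{\diamondsuit}y$ iff $\diamondsuit(x,y)=0$. $X$ is smooth if there is a unique supporting hyperplane at each point of the unit sphere (equivalently, the norm is Gâteaux differentiable at every nonzero point). ''Nonvanishing'' means not identically zero. *)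

(* Defs.v *)
From HB Require Import structures.
From mathcomp Require Import all_boot all_order all_algebra.
From mathcomp Require Import all_classical all_reals all_analysis.

Set Implicit Arguments.
Unset Strict Implicit.
Unset Printing Implicit Defensive.

Import Order.TTheory GRing.Theory Num.Theory.
Import numFieldNormedType.Exports.

Local Open Scope classical_set_scope.
Local Open Scope ring_scope.

(* In a normed space both one-sided limits exist, by convexity of the norm,
   so the totality of [lim] is harmless. *)
Definition rho_plus (R : realType) (X : normedModType R) (x y : X) : R :=
  lim ((`|x + t *: y| ^+ 2 - `|x| ^+ 2) / (2 * t) @[t --> (0 : R)^'+]).

Definition rho_minus (R : realType) (X : normedModType R) (x y : X) : R :=
  lim ((`|x + t *: y| ^+ 2 - `|x| ^+ 2) / (2 * t) @[t --> (0 : R)^'-]).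

Definition rho_star (R : realType) (X : normedModType R) (x y : X) : R :=
  rho_minus x y * rho_plus x y.

Definition perp_rho_plus (R : realType) (X : normedModType R) (x y : X) : Prop :=
  rho_plus x y = 0.

Definition perp_rho_minus (R : realType) (X : normedModType R) (x y : X) : Prop :=
  rho_minus x y = 0.

Definition perp_rho_star (R : realType) (X : normedModType R) (x y : X) : Prop :=
  rho_star x y = 0.

(* [H] is a closed affine hyperplane through [x] with the closed unit ball on
   one side of it. *)
Definition supporting_hyperplane (R : realType) (X : normedModType R)
    (x : X) (H : set X) : Prop :=
  exists (f : {linear X -> R}) (c : R),
    [/\ continuous f, exists v, f v != 0, H = [set y | f y = c], H x
      & forall y : X, `|y| <= 1 -> f y <= c].

Definition smooth (R : realType) (X : normedModType R) : Prop :=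
  forall x : X, `|x| = 1 -> exists! H : set X, supporting_hyperplane x H.

Definition dim_ge (R : realType) (X : normedModType R) (n : nat) : Prop :=
  exists e : 'I_n -> X, forall a : 'I_n -> R,
    \sum_(i < n) a i *: e i = 0 -> forall i, a i = 0.

Definition nonvanishing (R : realType) (X Y : normedModType R)
    (T : {linear X -> Y}) : Prop :=
  exists x : X, T x != 0.

(* Main.v *)
From HB Require Import structures.
Require Import Defs.
From mathcomp Require Import all_boot all_order all_algebra.
From mathcomp Require Import all_classical all_reals all_analysis.
From mathcomp Require Import ring lra.
Import Order.TTheory GRing.Theory Num.Theory.
Import numFieldNormedType.Exports.

Set Implicit Arguments.
Unset Strict Implicit.
Unset Printing Implicit Defensive.

Local Open Scope ring_scope.

(** Since the squared norm is convex, its difference quotient at [x] in the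
    direction [y] increases with the step, so [rho_plus x y] is the infimum of
    the quotients over positive steps. Hence [rho_plus x] is a sublinear
    functional bounded by [`|x| * `|y|], it satisfies
    [rho_plus x (y + a *: x) = rho_plus x y + a * `|x| ^+ 2], and
    [rho_minus x y = - rho_plus x (- y)].

    Smoothness amounts to [rho_plus x (- y) = - rho_plus x y] for all [x] and
    [y] ([smooth_rho_plusN]). At a unit vector [x], the linear functionals below
    [rho_plus x] give supporting hyperplanes, and all supporting hyperplanes
    arise in this way up to scaling. By Hahn-Banach ([hahn_banach_at]) some
    functional below [rho_plus x] takes the value [rho_plus x y] at [y], and
    another takes the value [- rho_plus x (- y)]; uniqueness of the hyperplane
    makes these values equal. Conversely, if [rho_plus x] is odd it is linear,
    so only one functional lies below it.

    If [X] is smooth, then [rho_star] is the square of [rho_plus] and the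
    identity is the required mapping. Conversely, let [T] carry
    [rho_star]-orthogonality to [rho_plus]-orthogonality. Correcting [y] by a
    multiple of [x] makes either norm derivative of [x] along [y] vanish, which
    yields ([star_to_plus_proportional])
    [`|x| ^+ 2 * rho_plus (T x) (T y) = `|T x| ^+ 2 * rho_plus x y] and
    the same with [rho_minus x y] on the right. So the two norm derivatives
    agree at [x] as soon as [T x] is nonzero, and it remains to see that [T] is
    injective ([star_to_plus_injective]): if [T x = 0] and [T z] is nonzero, the
    identity along the line [z + t *: x], on which [T] is constant, shows that
    the norm has zero derivative there; this is absurd for nonzero [x], because
    the norm is unbounded on the line. Replacing [y] by [- y] exchanges the
    assertions on [rho_plus] and [rho_minus]
    ([star_to_plus_iff_star_to_minus]). *)

(** * Sublinear functionals and the Hahn-Banach theorem *)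

Definition sublinear (R : realType) (V : lmodType R) (p : V -> R) : Prop :=
  (forall x y, p (x + y) <= p x + p y) /\
  (forall (a : R) x, 0 < a -> p (a *: x) = a * p x).

(** Homogeneity follows from one inequality, by applying it to [a] and to its
    inverse. *)
Lemma sublinear_intro (R : realType) (V : lmodType R) (p : V -> R) :
  (forall x y, p (x + y) <= p x + p y) ->
  (forall (a : R) x, 0 < a -> p (a *: x) <= a * p x) -> sublinear p.
Proof.
move=> pD pZ; split=> // a x a0; apply/eqP; rewrite eq_le pZ//=.
rewrite -ler_pdivlMl//; have := pZ a^-1 (a *: x); rewrite invr_gt0 => /(_ a0).
by rewrite scalerA mulVf ?scale1r// gt_eqF.
Qed.

Lemma sublinear0 (R : realType) (V : lmodType R) (p : V -> R) :
  sublinear p -> p 0 = 0.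
Proof. by move=> [_ /(_ 2 0)]; rewrite scaler0 => /(_ ltac:(lra)); lra. Qed.

Lemma sublinearZ (R : realType) (V : lmodType R) (p : V -> R) (a : R) x :
  sublinear p -> 0 <= a -> p (a *: x) = a * p x.
Proof.
move=> sp; rewrite le_eqVlt => /predU1P[<-|]; last exact: sp.2.
by rewrite scale0r mul0r sublinear0.
Qed.

Lemma sublinear_geN (R : realType) (V : lmodType R) (p : V -> R) x :
  sublinear p -> - p (- x) <= p x.
Proof.
move=> sp; have := sp.1 x (- x); rewrite subrr (sublinear0 sp); lra.
Qed.

(** The device that turns minimality into linearity: this functional lies below
    [p] (take [t = 0]) and is at most [p (x + y) - p y] (take [t = 1]), so it is
    strictly below [p] unless [p] is additive in the direction [y]. *)
Definition directional_inf (R : realType) (V : lmodType R) (p : V -> R)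
    (y x : V) : R :=
  inf [set p (x + t *: y) - t * p y | t in [set t | 0 <= t]]%classic.

Lemma directional_inf_le (R : realType) (V : lmodType R) (p : V -> R) y x t :
  sublinear p -> 0 <= t -> directional_inf p y x <= p (x + t *: y) - t * p y.
Proof.
move=> sp t0; apply: ge_inf; last by exists t.
exists (- p (- x)) => _ [s /= s0 <-].
have := sp.1 (x + s *: y) (- x).
rewrite addrAC subrr add0r (sublinearZ _ sp s0); lra.
Qed.

Lemma le_directional_inf (R : realType) (V : lmodType R) (p : V -> R) y x c :
  (forall t, 0 <= t -> c <= p (x + t *: y) - t * p y) ->
  c <= directional_inf p y x.
Proof.
move=> cp; apply: lb_le_inf.
  by exists (p (x + 0 *: y) - 0 * p y), 0 => /=.
by move=> _ [t /= t0 <-]; exact: cp.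
Qed.

Lemma sublinear_directional_inf (R : realType) (V : lmodType R) (p : V -> R) y :
  sublinear p -> sublinear (directional_inf p y).
Proof.
move=> sp; apply: sublinear_intro => [x z|a x a0].
  rewrite -lerBlDr; apply: le_directional_inf => s s0.
  rewrite lerBlDr -lerBlDl; apply: le_directional_inf => t t0.
  have st0 : 0 <= s + t by exact: addr_ge0.
  have := directional_inf_le y (x + z) sp st0.
  have := sp.1 (x + s *: y) (z + t *: y).
  rewrite addrACA -scalerDl; lra.
rewrite -ler_pdivrMl//; apply: le_directional_inf => t t0.
rewrite ler_pdivrMl//.
have at0 : 0 <= a * t by rewrite mulr_ge0// ltW.
have := directional_inf_le y (a *: x) sp at0.
by rewrite -scalerA -scalerDr sp.2// mulrBr mulrA.
Qed.

(** Zorn's lemma applies because the pointwise infimum of a chain of sublinear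
    functionals below [p] is again one: it is bounded below by [- p (- x)], and
    it is subadditive because the smaller of two members of the chain serves
    both summands. *)
Lemma exists_minimal_sublinear (R : realType) (V : lmodType R) (p : V -> R) :
  sublinear p ->
  exists q : V -> R, [/\ sublinear q, forall x, q x <= p x &
    forall r, sublinear r -> (forall x, r x <= q x) -> forall x, q x <= r x].
Proof.
move=> sp; pose T := {q : V -> R | sublinear q /\ forall x, q x <= p x}.
pose below (q r : T) := `[< forall x, sval r x <= sval q x >].
pose p' : T := exist _ p (conj sp (fun x => lexx (p x))).
have [| | |[q [sq qp]] qmin] := @ZL_preorder T p' below.
- by move=> q; apply/asboolP.
- move=> q r s /asboolP qr /asboolP rs; apply/asboolP => x.
  exact: le_trans (rs x) (qr x).
- move=> A totA; have [[q0 Aq0]|A0] := pselect (exists q, A q); last first.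
    by exists p' => q Aq; case: A0; exists q.
  pose m x := inf [set sval q x | q in A]%classic.
  have m_le q x : A q -> m x <= sval q x.
    move=> Aq; apply: ge_inf; last by exists q.
    exists (- p (- x)) => _ [[r [sr rp]] /= _ <-].
    by apply: le_trans (sublinear_geN _ sr); rewrite lerN2.
  have le_m c x : (forall q, A q -> c <= sval q x) -> c <= m x.
    move=> cq; apply: lb_le_inf; first by exists (sval q0 x), q0.
    by move=> _ [q Aq <-]; exact: cq.
  have sm : sublinear m.
    apply: sublinear_intro => [x y|a x a0].
      rewrite -lerBlDr; apply/le_m => q Aq.
      rewrite lerBlDr -lerBlDl; apply/le_m => r Ar.
      rewrite lerBlDl.
      have [/asboolP rq|/asboolP qr] := totA q r Aq Ar.
        have := m_le r (x + y) Ar; have := (svalP r).1.1 x y.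
        have := rq x; lra.
      have := m_le q (x + y) Aq; have := (svalP q).1.1 x y.
      have := qr y; lra.
    rewrite -ler_pdivrMl//; apply/le_m => q Aq; rewrite ler_pdivrMl//.
    by rewrite -(svalP q).1.2//; exact: m_le.
  have mp x : m x <= p x by apply: le_trans (m_le q0 x Aq0) ((svalP q0).2 x).
  by exists (exist _ m (conj sm mp)) => q Aq; apply/asboolP => x; exact: m_le.
- exists q; split=> // r sr rq.
  have rp x : r x <= p x by exact: le_trans (rq x) (qp x).
  by apply/asboolP; apply: (qmin (exist _ r (conj sr rp))); apply/asboolP.
Qed.

(** A minimal sublinear functional [q] coincides with [directional_inf q y] for
    every [y]; hence [q x + q y <= q (x + y)], and [q] is linear. *)
Lemma exists_linear_below (R : realType) (V : lmodType R) (p : V -> R) :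
  sublinear p -> exists f : {linear V -> R}, forall x, f x <= p x.
Proof.
move=> /exists_minimal_sublinear[q [sq qp qmin]].
have qD x y : q (x + y) = q x + q y.
  apply/eqP; rewrite eq_le sq.1/= -lerBrDr.
  have sr := sublinear_directional_inf y sq.
  have rq z : directional_inf q y z <= q z.
    have := directional_inf_le y z sq (lexx 0).
    by rewrite scale0r addr0 mul0r subr0.
  apply: le_trans (qmin _ sr rq x) _.
  by have := directional_inf_le y x sq ler01; rewrite scale1r mul1r.
have qN x : q (- x) = - q x.
  by have := qD x (- x); rewrite subrr (sublinear0 sq); lra.
have ql : linear q.
  move=> a x y; rewrite qD; congr (_ + _); have [a0|/ltW a0] := leP 0 a.
    exact: sublinearZ.
  rewrite -[a *: x]opprK -scaleNr qN.
  rewrite (sublinearZ _ sq); last by rewrite oppr_ge0.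
  by rewrite mulNr opprK.
pose H := GRing.isLinear.Build R V R _ q ql.
pose f : {linear V -> R} := HB.pack q H.
by exists f.
Qed.

(** A linear functional below [directional_inf p y] is below [p], and its value
    at [- y] is at most [- p y], so its value at [y] is [p y]. *)
Theorem hahn_banach_at (R : realType) (V : lmodType R) (p : V -> R) y :
  sublinear p ->
  exists f : {linear V -> R}, (forall x, f x <= p x) /\ f y = p y.
Proof.
move=> sp; have [f fr] := exists_linear_below (sublinear_directional_inf y sp).
have fp x : f x <= p x.
  apply: le_trans (fr x) _.
  have := directional_inf_le y x sp (lexx 0).
  by rewrite scale0r addr0 mul0r subr0.
exists f; split=> //; apply/eqP; rewrite eq_le fp/=.
have := le_trans (fr (- y)) (directional_inf_le y (- y) sp ler01).
by rewrite scale1r addNr (sublinear0 sp) mul1r sub0r linearN lerN2.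
Qed.

(** * The norm derivative as an infimum of difference quotients *)

Definition sqnorm_slope (R : realType) (X : normedModType R) (x y : X)
    (t : R) : R :=
  (`|x + t *: y| ^+ 2 - `|x| ^+ 2) / (2 * t).

Lemma le_sqnorm_slope (R : realType) (X : normedModType R) (x y : X) (t c : R) :
  0 < t ->
  (c <= sqnorm_slope x y t) = (`|x| ^+ 2 + 2 * t * c <= `|x + t *: y| ^+ 2).
Proof.
move=> t0; rewrite /sqnorm_slope ler_pdivlMr; last by rewrite mulr_gt0.
by rewrite lerBrDl [c * _]mulrC.
Qed.

Lemma sqnorm_slope_le (R : realType) (X : normedModType R) (x y : X) (t c : R) :
  0 < t ->
  (sqnorm_slope x y t <= c) = (`|x + t *: y| ^+ 2 <= `|x| ^+ 2 + 2 * t * c).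
Proof.
move=> t0; rewrite /sqnorm_slope ler_pdivrMr; last by rewrite mulr_gt0.
by rewrite lerBlDl [c * _]mulrC.
Qed.

Lemma sqnormE (R : realType) (X : normedModType R) (x y : X) (t : R) :
  0 < t -> `|x + t *: y| ^+ 2 = `|x| ^+ 2 + 2 * t * sqnorm_slope x y t.
Proof. by move=> t0; rewrite /sqnorm_slope; field; rewrite gt_eqF. Qed.

Lemma sqnorm_convex (R : realType) (X : normedModType R) (u v : X) (l : R) :
  0 <= l <= 1 ->
  `|(1 - l) *: u + l *: v| ^+ 2 <= (1 - l) * `|u| ^+ 2 + l * `|v| ^+ 2.
Proof.
move=> /andP[l0 l1].
have : `|(1 - l) *: u + l *: v| <= (1 - l) * `|u| + l * `|v|.
  apply: le_trans (ler_normD _ _) _.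
  by rewrite !normrZ !ger0_norm// subr_ge0.
have := normr_ge0 ((1 - l) *: u + l *: v).
move: `|_ + _| `|u| `|v| => n a b n0 nab.
have : n ^+ 2 <= ((1 - l) * a + l * b) ^+ 2.
  by rewrite ler_sqr// nnegrE// (le_trans n0).
move/le_trans; apply; rewrite -subr_ge0.
have -> : (1 - l) * a ^+ 2 + l * b ^+ 2 - ((1 - l) * a + l * b) ^+ 2 =
  l * (1 - l) * (a - b) ^+ 2 by ring.
by rewrite mulr_ge0 ?sqr_ge0// mulr_ge0// subr_ge0.
Qed.

(** [x + s *: y] is the convex combination of [x] and [x + t *: y] with weight
    [s / t]. *)
Lemma sqnorm_slope_nondecreasing (R : realType) (X : normedModType R) (x y : X)
    (s t : R) :
  0 < s -> s <= t -> sqnorm_slope x y s <= sqnorm_slope x y t.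
Proof.
move=> s0 st; have t0 : 0 < t by exact: lt_le_trans st.
rewrite sqnorm_slope_le//.
have l01 : 0 <= s / t <= 1.
  by rewrite divr_ge0 ?(ltW s0) ?(ltW t0)//= ler_pdivrMr// mul1r.
have := sqnorm_convex x (x + t *: y) l01.
rewrite scalerDr addrA -scalerDl subrK scale1r scalerA divfK ?gt_eqF//.
move/le_trans; apply; rewrite sqnormE// le_eqVlt; apply/orP; left.
by apply/eqP; field; rewrite gt_eqF.
Qed.

(** This bound makes the infimum over the steps finite; it comes from the
    reverse triangle inequality. *)
Lemma sqnorm_slope_ge (R : realType) (X : normedModType R) (x y : X) (t : R) :
  0 < t -> - (`|x| * `|y|) <= sqnorm_slope x y t.
Proof.
move=> t0; rewrite le_sqnorm_slope//.
have : (`|x| - t * `|y|) ^+ 2 <= `|x + t *: y| ^+ 2.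
  have := lerB_normD x (t *: y); have := lerB_normD (t *: y) x.
  rewrite [t *: y + x]addrC normrZ gtr0_norm// => h1 h2.
  by rewrite -[leLHS]real_normK ?num_real// ler_sqr ?nnegrE// ler_norml; lra.
have := sqr_ge0 (t * `|y|); lra.
Qed.

Lemma cvg_sqnorm_slope (R : realType) (X : normedModType R) (x y : X) :
  (sqnorm_slope x y t @[t --> (0 : R)^'+] -->
    inf [set sqnorm_slope x y t | t in `]0, +oo[ ])%classic.
Proof.
apply: (@nondecreasing_at_right_cvgr _ (sqnorm_slope x y) 0 +oo%O) => //.
  move=> s t; rewrite !in_itv/= !andbT => s0 _ st.
  exact: sqnorm_slope_nondecreasing.
exists (- (`|x| * `|y|)) => _ [t /= + <-]; rewrite in_itv/= andbT => t0.
exact: sqnorm_slope_ge.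
Qed.

Lemma rho_plus_inf (R : realType) (X : normedModType R) (x y : X) :
  rho_plus x y = inf [set sqnorm_slope x y t | t in `]0, +oo[ ]%classic.
Proof. by apply: cvg_lim => //; exact: cvg_sqnorm_slope. Qed.

Lemma rho_plus_le_slope (R : realType) (X : normedModType R) (x y : X) (t : R) :
  0 < t -> rho_plus x y <= sqnorm_slope x y t.
Proof.
move=> t0; rewrite rho_plus_inf; apply: ge_inf; last first.
  by exists t => //=; rewrite in_itv/= t0.
exists (- (`|x| * `|y|)) => _ [s /= + <-]; rewrite in_itv/= andbT => s0.
exact: sqnorm_slope_ge.
Qed.

Lemma le_rho_plus (R : realType) (X : normedModType R) (x y : X) (c : R) :
  (forall t, 0 < t -> c <= sqnorm_slope x y t) -> c <= rho_plus x y.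
Proof.
move=> cq; rewrite rho_plus_inf; apply: lb_le_inf.
  by exists (sqnorm_slope x y 1), 1 => //=; rewrite in_itv/= ltr01.
by move=> _ [s /= + <-]; rewrite in_itv/= andbT => s0; exact: cq.
Qed.

Lemma rho_minusE (R : realType) (X : normedModType R) (x y : X) :
  rho_minus x y = - rho_plus x (- y).
Proof.
apply: cvg_lim => //; apply/cvg_at_leftNP; rewrite oppr0.
rewrite rho_plus_inf.
refine (cvg_trans _ (cvgN (@cvg_sqnorm_slope _ _ x (- y)))).
apply: near_eq_cvg; apply: nearW => t.
transitivity (- sqnorm_slope x (- y) t); first by [].
by rewrite /= /sqnorm_slope scalerN scaleNr mulrN invrN mulrN.
Qed.

(** For subadditivity, [x + (m / 2) *: (y + z)] is the midpoint of [x + m *: y]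
    and [x + m *: z]; monotonicity of the quotients permits a common step [m]
    for both directions. *)
Lemma rho_plus_sublinear (R : realType) (X : normedModType R) (x : X) :
  sublinear (rho_plus x).
Proof.
apply: sublinear_intro => [y z|a y a0].
  rewrite -lerBlDr; apply: le_rho_plus => s s0.
  rewrite lerBlDr -lerBlDl; apply: le_rho_plus => t t0.
  rewrite lerBlDl.
  pose m := Num.min s t.
  have m0 : 0 < m by rewrite lt_min s0.
  have ys : sqnorm_slope x y m <= sqnorm_slope x y s.
    by apply: sqnorm_slope_nondecreasing => //; rewrite ge_min lexx.
  have zt : sqnorm_slope x z m <= sqnorm_slope x z t.
    by apply: sqnorm_slope_nondecreasing => //; rewrite ge_min lexx orbT.
  apply: le_trans (lerD ys zt).
  have m20 : 0 < m / 2 by rewrite divr_gt0.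
  apply: le_trans (rho_plus_le_slope x (y + z) m20) _.
  rewrite sqnorm_slope_le//.
  have l01 : 0 <= (2^-1 : R) <= 1 by lra.
  have := sqnorm_convex (x + m *: y) (x + m *: z) l01.
  have -> : (1 - 2^-1) *: (x + m *: y) + 2^-1 *: (x + m *: z) =
      x + (m / 2) *: (y + z) :> X.
    have -> : 1 - 2^-1 = 2^-1 :> R by lra.
    rewrite -scalerDr addrACA -(scalerDr m) (scalerDr 2^-1).
    rewrite scalerA [2^-1 * m]mulrC.
    by rewrite -[X in X + X]scale1r -scalerDl scalerA mulVf// scale1r.
  rewrite !sqnormE//; lra.
rewrite -ler_pdivrMl//; apply: le_rho_plus => t t0; rewrite ler_pdivrMl//.
have ta0 : 0 < t / a by rewrite divr_gt0.
apply: le_trans (rho_plus_le_slope x (a *: y) ta0) _.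
rewrite /sqnorm_slope scalerA divfK ?gt_eqF// le_eqVlt; apply/orP; left.
by apply/eqP; field; rewrite !gt_eqF.
Qed.

Lemma rho_plusZl (R : realType) (X : normedModType R) (x y : X) (a : R) :
  0 < a -> rho_plus (a *: x) y = a * rho_plus x y.
Proof.
move=> a0.
have slopeZ t : 0 < t ->
    sqnorm_slope (a *: x) y t = a * sqnorm_slope x y (t / a).
  move=> t0; rewrite /sqnorm_slope.
  have -> : a *: x + t *: y = a *: (x + (t / a) *: y).
    by rewrite scalerDr scalerA mulrCA divff ?mulr1 ?gt_eqF.
  by rewrite !normrZ !gtr0_norm//; field; rewrite !gt_eqF.
apply/eqP; rewrite eq_le; apply/andP; split.
  rewrite -ler_pdivrMl//; apply: le_rho_plus => t t0; rewrite ler_pdivrMl//.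
  have ta0 : 0 < t * a by rewrite mulr_gt0.
  apply: le_trans (rho_plus_le_slope _ _ ta0) _.
  by rewrite slopeZ// mulfK ?gt_eqF.
apply: le_rho_plus => t t0; rewrite slopeZ// ler_pM2l//.
by apply: rho_plus_le_slope; rewrite divr_gt0.
Qed.

(** Upper bounds for an infimum that is only approached as the step vanishes. *)
Lemma rho_plus_le_of_affine_bound (R : realType) (X : normedModType R)
    (x y : X) (c d : R) :
  (forall t, 0 < t -> sqnorm_slope x y t <= c + t * d) -> rho_plus x y <= c.
Proof.
move=> qcd; apply/ler_addgt0Pr => e e0.
have d0 : 0 < `|d| + 1 by rewrite ltr_wpDl.
have t0 : 0 < e / (`|d| + 1) by rewrite divr_gt0.
apply: le_trans (rho_plus_le_slope _ _ t0) _; apply: le_trans (qcd _ t0) _.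
rewrite lerD2l mulrAC ler_pdivrMr// ler_pM2l//.
by apply: le_trans (ler_norm d) _; rewrite lerDl.
Qed.

Lemma rho_plus_self (R : realType) (X : normedModType R) (x : X) (a : R) :
  rho_plus x (a *: x) = a * `|x| ^+ 2.
Proof.
have slopeE t : 0 < t ->
    sqnorm_slope x (a *: x) t = (a + t * a ^+ 2 / 2) * `|x| ^+ 2.
  move=> t0; rewrite /sqnorm_slope scalerA -[X in `|X + _|]scale1r -scalerDl.
  rewrite normrZ exprMn real_normK ?num_real//; field; by rewrite gt_eqF.
apply/eqP; rewrite eq_le; apply/andP; split; last first.
  apply: le_rho_plus => t t0; rewrite slopeE// ler_wpM2r ?sqr_ge0// lerDl.
  by rewrite divr_ge0// mulr_ge0 ?sqr_ge0// ltW.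
apply: (@rho_plus_le_of_affine_bound _ _ _ _ _ (a ^+ 2 / 2 * `|x| ^+ 2)).
move=> t t0.
by rewrite slopeE// le_eqVlt; apply/orP; left; apply/eqP; ring.
Qed.

(** Subadditivity gives one inequality, and applied to
    [y = (y + a *: x) - a *: x] it gives the other. *)
Lemma rho_plusDself (R : realType) (X : normedModType R) (x y : X) (a : R) :
  rho_plus x (y + a *: x) = rho_plus x y + a * `|x| ^+ 2.
Proof.
have [sub _] := rho_plus_sublinear x.
have := sub y (a *: x); have := sub (y + a *: x) ((- a) *: x).
rewrite !rho_plus_self scaleNr addrK; lra.
Qed.

Lemma rho_plus_le_norm (R : realType) (X : normedModType R) (x y : X) :
  rho_plus x y <= `|x| * `|y|.
Proof.
apply: (@rho_plus_le_of_affine_bound _ _ _ _ _ (`|y| ^+ 2 / 2)) => t t0.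
rewrite sqnorm_slope_le//.
have : `|x + t *: y| <= `|x| + t * `|y|.
  by rewrite -{2}(gtr0_norm t0) -normrZ ler_normD.
have := normr_ge0 (x + t *: y); move: `|x + _| `|x| `|y| => n a b n0 nab.
have : n ^+ 2 <= (a + t * b) ^+ 2 by rewrite ler_sqr// nnegrE// (le_trans n0).
lra.
Qed.

(** * Supporting hyperplanes and smoothness *)

(** The conclusion uses the product of the field where [linearZ] leaves the
    scaling of the field seen as a module over itself. *)
Lemma linear_formZ (R : realType) (V : lmodType R) (f : {linear V -> R})
    (a : R) (x : V) :
  f (a *: x) = a * f x.
Proof. by rewrite linearZ. Qed.

(** The value at [x] is pinned from both sides, because [rho_plus x] is linear
    on the line spanned by [x]. *)
Lemma below_rho_plus_self (R : realType) (X : normedModType R) (x : X)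
    (f : {linear X -> R}) :
  (forall z, f z <= rho_plus x z) -> f x = `|x| ^+ 2.
Proof.
move=> f_rho; have := f_rho (1 *: x); have := f_rho ((-1) *: x).
rewrite !rho_plus_self scaleN1r scale1r linearN; lra.
Qed.

Lemma below_rho_plus_supporting (R : realType) (X : normedModType R) (x : X)
    (f : {linear X -> R}) :
  `|x| = 1 -> (forall z, f z <= rho_plus x z) ->
  supporting_hyperplane x [set z | f z = 1]%classic.
Proof.
move=> x1 f_rho; exists f, 1.
have f_norm z : f z <= `|z|.
  apply: le_trans (f_rho z) _; have := rho_plus_le_norm x z.
  by rewrite x1 mul1r.
have fx : f x = 1 by rewrite below_rho_plus_self// x1 expr1n.
split=> //.
- apply: (@bounded_linear_continuous R X R^o f); apply/linear_boundedP.
  near=> r => z; rewrite ler_norml.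
  have r1 : 1 <= r by near: r; exact: nbhs_pinfty_ge.
  have zr : `|z| <= r * `|z| by rewrite ler_peMl.
  have := f_norm z; have := f_norm (- z); rewrite linearN normrN.
  by move=> h1 h2; lra.
- by exists x; rewrite fx oner_neq0.
- by move=> z z1; exact: le_trans z1.
Unshelve. all: by end_near. Qed.

(** Every vector has a translate along [x] in the common level set. *)
Lemma linear_eq_of_level_set (R : realType) (V : lmodType R)
    (f g : {linear V -> R}) (x : V) :
  f x = 1 -> g x = 1 ->
  [set z | f z = 1]%classic = [set z | g z = 1]%classic ->
  forall z, f z = g z.
Proof.
move=> fx gx fg z.
have : f (z + (1 - f z) *: x) = 1 by rewrite linearD linear_formZ fx mulr1; lra.
have -> : (f (z + (1 - f z) *: x) = 1) = (g (z + (1 - f z) *: x) = 1).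
  exact: (congr1 (fun A => A (z + (1 - f z) *: x)) fg).
by rewrite linearD linear_formZ gx mulr1; lra.
Qed.

Lemma rho_plus0l (R : realType) (X : normedModType R) (y : X) :
  rho_plus 0 y = 0.
Proof.
apply/eqP; rewrite eq_le; apply/andP; split.
  by have := rho_plus_le_norm 0 y; rewrite normr0 mul0r.
apply: le_rho_plus => t t0.
by have := sqnorm_slope_ge 0 y t0; rewrite normr0 mul0r oppr0.
Qed.

Lemma unit_vectorE (R : realType) (X : normedModType R) (x : X) :
  x != 0 -> exists u, `|u| = 1 /\ x = `|x| *: u.
Proof.
move=> x0; have nx : `|x| != 0 by rewrite normr_eq0.
exists (`|x|^-1 *: x); split; last by rewrite scalerA divff ?scale1r.
by rewrite normrZ normfV normr_id mulVf.
Qed.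

(** Smoothness in terms of norm derivatives, the right-hand side being a
    restatement of [rho_minus = rho_plus] by [rho_minusE]. For the converse, a
    functional [g] that attains its bound [c] on the unit ball at [x] satisfies
    [g <= c * rho_plus x]; if [rho_plus x] is odd, this forces equality. *)
Lemma smooth_rho_plusN (R : realType) (X : normedModType R) :
  smooth X <-> forall x y : X, rho_plus x (- y) = - rho_plus x y.
Proof.
split=> [smX x y|rhoN x x1].
  have [->|x0] := eqVneq x 0; first by rewrite !rho_plus0l oppr0.
  have [u [u1 ->]] := unit_vectorE x0.
  rewrite !rho_plusZl ?normr_gt0// -mulrN; congr (_ * _).
  have [f [f_rho fy]] := hahn_banach_at y (rho_plus_sublinear u).
  have [g [g_rho gy]] := hahn_banach_at (- y) (rho_plus_sublinear u).
  have [H [_ Huniq]] := smX u u1.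
  rewrite -fy -gy linearN; congr (- _).
  have fu : f u = 1 by rewrite below_rho_plus_self// u1 expr1n.
  have gu : g u = 1 by rewrite below_rho_plus_self// u1 expr1n.
  apply: (linear_eq_of_level_set gu fu).
  by rewrite -(Huniq _ (below_rho_plus_supporting u1 f_rho))
             -(Huniq _ (below_rho_plus_supporting u1 g_rho)).
have [f f_rho] := exists_linear_below (rho_plus_sublinear x).
exists [set z | f z = 1]%classic; split; first exact: below_rho_plus_supporting.
move=> _ [g [c [_ [v gv] -> /= gx gc]]].
have g_norm z : g z <= c * `|z|.
  have [->|z0] := eqVneq z 0; first by rewrite linear0 normr0 mulr0.
  have [u [u1 ->]] := unit_vectorE z0.
  rewrite linear_formZ normrZ u1 mulr1 normr_id mulrC ler_wpM2r//.
  by rewrite gc// u1.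
have c0 : 0 < c.
  have v0 : 0 < `|v|.
    by rewrite normr_gt0; apply: contraNneq gv => ->; rewrite linear0.
  rewrite -(pmulr_lgt0 _ v0); have := g_norm v; have := g_norm (- v).
  by rewrite linearN normrN; move: gv; rewrite neq_lt => /orP[] gv h1 h2; lra.
have g_rho z : g z <= c * rho_plus x z.
  rewrite -ler_pdivrMl//; apply: le_rho_plus => t t0.
  rewrite le_sqnorm_slope// x1 expr1n.
  have : 1 + t * (c^-1 * g z) <= `|x + t *: z|.
    rewrite -(ler_pM2l c0); apply: le_trans (g_norm _).
    rewrite linearD linear_formZ gx le_eqVlt; apply/orP; left.
    by apply/eqP; field; rewrite gt_eqF.
  (* [n ^+ 2 >= 2 * n - 1] turns a bound on the norm into one on its square. *)
  have := sqr_ge0 (`|x + t *: z| - 1); lra.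
have fE z : f z = rho_plus x z.
  apply/eqP; rewrite eq_le f_rho/=.
  by have := f_rho (- z); rewrite linearN rhoN lerN2.
have gE z : g z = c * f z.
  apply/eqP; rewrite eq_le fE g_rho/=.
  by have := g_rho (- z); rewrite linearN rhoN mulrN lerN2.
apply/seteqP; split=> z /=; rewrite gE; first by move=> ->; rewrite mulr1.
by rewrite -[RHS]mulr1; apply: mulfI; rewrite gt_eqF.
Qed.

(** * Mappings carrying rho_star-orthogonality to rho_plus-orthogonality *)

Lemma perp_rho_starP (R : realType) (X : normedModType R) (x y : X) :
  perp_rho_star x y <-> rho_plus x (- y) = 0 \/ rho_plus x y = 0.
Proof.
rewrite /perp_rho_star /rho_star rho_minusE; split.
  by move/eqP; rewrite mulf_eq0 oppr_eq0 => /orP[/eqP|/eqP]; [left|right].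
by case=> ->; rewrite ?oppr0 ?mul0r ?mulr0.
Qed.

(** [rho_star]-orthogonality is invariant under [y] to [- y], which exchanges
    the two one-sided derivatives in the conclusion. *)
Lemma star_to_plus_iff_star_to_minus (R : realType) (X Y : normedModType R)
    (T : {linear X -> Y}) :
  (forall x y, perp_rho_star x y -> perp_rho_plus (T x) (T y)) <->
  (forall x y, perp_rho_star x y -> perp_rho_minus (T x) (T y)).
Proof.
have starN x y : perp_rho_star x y -> perp_rho_star x (- y :> X).
  by rewrite !perp_rho_starP opprK => -[]; [right|left].
split=> pT x y /starN /pT; rewrite /perp_rho_plus /perp_rho_minus linearN.
  by rewrite rho_minusE => ->; rewrite oppr0.
by rewrite rho_minusE opprK => /eqP; rewrite oppr_eq0 => /eqP.
Qed.

(** The two multiples of [x] that make [rho_plus x] and [rho_minus x] vanish at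
    the corrected vector both produce [rho_star]-orthogonal pairs; evaluating
    the conclusion on them computes [rho_plus (T x) (T y)] in two ways. *)
Lemma star_to_plus_proportional (R : realType) (X Y : normedModType R)
    (T : {linear X -> Y}) :
  (forall x y, perp_rho_star x y -> perp_rho_plus (T x) (T y)) ->
  forall x y, `|x| ^+ 2 * rho_plus (T x) (T y) = `|T x| ^+ 2 * rho_plus x y /\
    `|x| ^+ 2 * rho_plus (T x) (T y) = - (`|T x| ^+ 2 * rho_plus x (- y)).
Proof.
move=> pT x y.
have [->|x0] := eqVneq x 0.
  by rewrite linear0 !normr0 expr0n/= !mul0r oppr0.
have n0 : `|x| ^+ 2 != 0 by rewrite expf_neq0// normr_eq0.
have key a : perp_rho_star x (y + a *: x) ->
    rho_plus (T x) (T y) = - (a * `|T x| ^+ 2).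
  move/pT; rewrite /perp_rho_plus linearD linearZ rho_plusDself => /eqP.
  by rewrite addr_eq0 => /eqP.
split.
  rewrite (key (- (rho_plus x y / `|x| ^+ 2)));
    first by field; rewrite normr_eq0.
  by apply/perp_rho_starP; right; rewrite rho_plusDself mulNr divfK// subrr.
rewrite (key (rho_plus x (- y) / `|x| ^+ 2)); first by field; rewrite normr_eq0.
apply/perp_rho_starP; left.
by rewrite opprD -scaleNr rho_plusDself mulNr divfK// subrr.
Qed.

Lemma rho_plus_eq0_norm_le (R : realType) (X : normedModType R) (x y : X)
    (t : R) :
  0 < t -> rho_plus x y = 0 -> `|x| <= `|x + t *: y|.
Proof.
move=> t0 rho0; have := rho_plus_le_slope x y t0.
by rewrite rho0 le_sqnorm_slope// mulr0 addr0 ler_sqr// nnegrE.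
Qed.

(** If [T x = 0], then for every [t] the norm derivative at [z + t *: x] along
    [- x] vanishes, so by convexity the norm at [z + t *: x] is at most the norm
    of [z], for every positive [t]. *)
Lemma star_to_plus_injective (R : realType) (X Y : normedModType R)
    (T : {linear X -> Y}) :
  nonvanishing T ->
  (forall x y, perp_rho_star x y -> perp_rho_plus (T x) (T y)) ->
  forall x, T x = 0 -> x = 0.
Proof.
move=> [z Tz] pT x Tx; apply/eqP; apply: contraT => x0.
have Tu t : T (z + t *: x) = T z by rewrite linearD linearZ/= Tx scaler0 addr0.
have n0 : `|T z| ^+ 2 != 0 by rewrite expf_neq0// normr_eq0.
have rho0 t : rho_plus (z + t *: x) (- x) = 0.
  have [+ _] := star_to_plus_proportional pT (z + t *: x) (- x).
  rewrite linearN Tx oppr0 Tu.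
  have -> : rho_plus (T z) 0 = 0 by exact: sublinear0 (rho_plus_sublinear _).
  by rewrite mulr0 => /esym/eqP; rewrite mulf_eq0 (negbTE n0) => /eqP.
have nx : 0 < `|x| by rewrite normr_gt0.
(* With this step [`|t *: x|] exceeds [2 * `|z|], so [z + t *: x] is longer
   than [z]. *)
pose t := (2 * `|z| + 1) / `|x|.
have t0 : 0 < t by rewrite divr_gt0// ltr_wpDl// mulr_ge0.
have := rho_plus_eq0_norm_le t0 (rho0 t).
rewrite scalerN addrK.
have := lerB_normD (t *: x) z.
rewrite [t *: x + z]addrC normrZ gtr0_norm// /t divfK ?gt_eqF//; lra.
Qed.

Lemma star_to_plus_smooth (R : realType) (X Y : normedModType R)
    (T : {linear X -> Y}) :
  nonvanishing T ->
  (forall x y, perp_rho_star x y -> perp_rho_plus (T x) (T y)) -> smooth X.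
Proof.
move=> nvT pT; apply/smooth_rho_plusN => x y.
have [->|x0] := eqVneq x 0; first by rewrite !rho_plus0l oppr0.
have Tx0 : `|T x| ^+ 2 != 0.
  rewrite expf_neq0// normr_eq0; apply: contraNneq x0 => Tx0.
  by apply/eqP; exact: (star_to_plus_injective nvT pT Tx0).
have [-> /eqP] := star_to_plus_proportional pT x y.
by rewrite -mulrN (inj_eq (mulfI Tx0)) => /eqP ->; rewrite opprK.
Qed.

Lemma smooth_star_to_plus (R : realType) (X : normedModType R) :
  smooth X -> forall x y : X, perp_rho_star x y -> perp_rho_plus x y.
Proof.
move=> /smooth_rho_plusN rhoN x y /perp_rho_starP[|//].
by rewrite rhoN => /eqP; rewrite oppr_eq0 => /eqP.
Qed.

Theorem theorem3p2 (R : realType) (X : normedModType R) (hX : dim_ge X 2) :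
  (smooth X <->
     exists (Y : normedModType R) (T : {linear X -> Y}),
       nonvanishing T /\
       forall x y : X, perp_rho_star x y -> perp_rho_plus (T x) (T y))
  /\
  (smooth X <->
     exists (Y : normedModType R) (T : {linear X -> Y}),
       nonvanishing T /\
       forall x y : X, perp_rho_star x y -> perp_rho_minus (T x) (T y)).
Proof.
have nv : nonvanishing (idfun : {linear X -> X}).
  have [e efree] := hX; exists (e ord0); apply/eqP => /= e0.
  suff /(efree (fun i => (i == ord0)%:R))/(_ ord0)/eqP :
      \sum_(i < 2) (i == ord0)%:R *: e i = 0 :> X by rewrite eqxx oner_eq0.
  rewrite big_ord_recl big1 ?addr0 => [|i _]; last by rewrite scale0r.
  by rewrite eqxx scale1r.
split; split.
- by move=> smX; exists X, idfun; split=> //; exact: smooth_star_to_plus.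
- by move=> [Y [T [nvT pT]]]; exact: star_to_plus_smooth pT.
- move=> smX; exists X, idfun; split=> //.
  apply/(star_to_plus_iff_star_to_minus (idfun : {linear X -> X})).
  exact: smooth_star_to_plus.
- move=> [Y [T [nvT /star_to_plus_iff_star_to_minus pT]]].
  exact: star_to_plus_smooth pT.
Qed.
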